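(* Let $G$ be a countably infinite discrete amenable group and let $\{F_n\}$ be a Følner sequence of $G$ satisfying $e_G\in F_1\subseteq F_2\subseteq\cdots$. Then every finite-alphabet $G$-subshift is D-hereditarily lowerable along $\{F_n\}$.
   Context: A Følner sequence is a sequence $\{F_n\}$ of nonempty finite subsets of $G$ with $|F_n\triangle sF_n|/|F_n|\to0$ for every $s\in G$; $e_G$ is the identity of $G$. A finite-alphabet $G$-subshift is a closed $G$-invariant subset $\Sigma\subseteq A^G$, where $A$ is a finite set with $|A|\ge2$ and $G$ acts by $(gx)(u)=x(ug)$, $g,u\in G$. Bowen topological entropy of a subset $K$ of a compact metric space $X$ with continuous $G$-action: for a finite open cover $\mathcal U$ of $X$ and $\mathbb U=\{U_g\}_{g\in F_n}$ with $U_g\in\mathcal U$, put $m(\mathbb U)=|F_n|$ and $X(\mathbb U)=\bigcap_{g\in F_n}g^{-1}U_g$; let $\mathcal W_{F_n}(\mathcal U)$ be the set of all such $\mathbb U$. For $s\ge0$, $N\in\mathbb N$, let $\mathcal M(K,\mathcal U,N,s,\{F_n\})=\inf\sum_{\mathbb U\in\Lambda}e^{-s\,m(\mathbb U)}$, the infimum over all $\Lambda\subseteq\bigcup_{j\ge N}\mathcal W_{F_j}(\mathcal U)$ with $K\subseteq\bigcup_{\mathbb U\in\Lambda}X(\mathbb U)$; $\mathcal M(K,\mathcal U,s,\{F_n\})=\lim_{N\to\infty}\mathcal M(K,\mathcal U,N,s,\{F_n\})$. Then $h_{\mathrm{top}}^B(K,\mathcal U,\{F_n\})=\inf\{s:\mathcal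 M(K,\mathcal U,s,\{F_n\})=0\}$ and $h_{\mathrm{top}}^B(K,\{F_n\})=\sup_{\mathcal U}h_{\mathrm{top}}^B(K,\mathcal U,\{F_n\})$ over finite open covers $\mathcal U$. A system $X$ is D-hereditarily lowerable along $\{F_n\}$ if for every nonempty Souslin (i.e. analytic) set $K\subseteq X$ and every $0\le h\le h_{\mathrm{top}}^B(K,\{F_n\})$ there is a set $K_h\subseteq K$ with $h_{\mathrm{top}}^B(K_h,\{F_n\})=h$. *)

(* Defs.v *)
From HB Require Import structures.
From mathcomp Require Import all_boot all_order all_algebra.
From mathcomp Require Import finmap.
From mathcomp Require Import all_classical all_reals all_analysis.

Set Implicit Arguments.
Unset Strict Implicit.
Unset Printing Implicit Defensive.

Import Order.TTheory GRing.Theory Num.Theory.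
Import numFieldNormedType.Exports.

Local Open Scope classical_set_scope.
Local Open Scope ring_scope.

Section folner.
Context (R : realType) (G : groupType).

Definition ltrans (s : G) (E : {fset G}) : {fset G} :=
  [fset (s * g)%g | g in E]%fset.

Definition fsymdiff (E E' : {fset G}) : {fset G} :=
  ((E `\` E') `|` (E' `\` E))%fset.

Definition is_folner (F : nat -> {fset G}) : Prop :=
  (forall n, F n != fset0) /\
  (forall s : G,
     ((#|` fsymdiff (F n) (ltrans s (F n))|%:R / #|` F n|%:R : R)
        @[n --> \oo] --> (0 : R))).

Definition amenable : Prop := exists F, is_folner F.

End folner.

Section bowen_entropy.
Context (R : realType) (G : groupType) (X : topologicalType).
Context (act : G -> X -> X) (F : nat -> {fset G}).

Definition finite_open_cover (U : set (set X)) : Prop :=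
  [/\ finite_set U, (forall V, U V -> open V) & \bigcup_(V in U) V = setT].

(* A family {U_g}_(g in E) is a finite map whose domain is E; families over
   different index sets are thus distinct elements of one choiceType. *)
Definition words (U : set (set X)) (E : {fset G}) : set {fmap G -> set X} :=
  [set w | domf w = E /\ forall g : domf w, U (w g)].

Definition word_set (w : {fmap G -> set X}) : set X :=
  \bigcap_(g in [set: domf w]) (act (val g) @^-1` w g).

Definition bowen_coverings (K : set X) (U : set (set X)) (N : nat) :
    set (set {fmap G -> set X}) :=
  [set L | L `<=` \bigcup_(j in [set j | (N <= j)%N]) words U (F j) /\
           K `<=` \bigcup_(w in L) word_set w].

Definition bowen_sum (s : R) (L : set {fmap G -> set X}) : \bar R :=
  \esum_(w in L) (expR (- s * #|` domf w|%:R))%:E.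

Definition bowen_preM (K : set X) (U : set (set X)) (N : nat) (s : R) : \bar R :=
  ereal_inf (bowen_sum s @` bowen_coverings K U N).

Definition bowen_M (K : set X) (U : set (set X)) (s : R) : \bar R :=
  limn (fun N => bowen_preM K U N s).

Definition bowen_entropy_cover (K : set X) (U : set (set X)) : \bar R :=
  ereal_inf [set s%:E | s in [set s : R | 0 <= s /\ bowen_M K U s = 0%E]].

Definition bowen_entropy (K : set X) : \bar R :=
  ereal_sup (bowen_entropy_cover K @` finite_open_cover).

End bowen_entropy.

(* Continuous images of the Baire space of sequences of naturals. *)
Definition souslin (X : topologicalType) (K : set X) : Prop :=
  K = set0 \/
  exists2 f : {ptws nat -> nat} -> X, continuous f & range f = K.

Definition D_hereditarily_lowerable (R : realType) (G : groupType)
    (X : topologicalType) (act : G -> X -> X) (F : nat -> {fset G}) : Prop :=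
  forall K : set X, K !=set0 -> souslin K ->
  forall h : \bar R, (0 <= h)%E -> (h <= bowen_entropy R act F K)%E ->
  exists2 Kh : set X, Kh `<=` K & bowen_entropy R act F Kh = h.

Notation full_shift G A := {ptws G -> discrete_topology A}.

Definition shift_act (G : groupType) (A : finType) (g : G) (x : full_shift G A) :
  full_shift G A := fun u => x (u * g)%g.

Record subshift (G : groupType) (A : finType) := Subshift {
  subshift_set :> set (full_shift G A);
  subshift_closed : closed subshift_set;
  subshift_invariant :
    forall (g : G) x, subshift_set x -> subshift_set (shift_act g x) }.

(* The points of S form the space [set_type S], with the topology induced by
   the product topology. *)
Definition subshift_act (G : groupType) (A : finType) (S : subshift G A)
    (g : G) (x : set_type S) : set_type S :=
  SigSub (mem_set (subshift_invariant g (set_valP x))).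

(* Main.v *)
(** Give a pattern on [F n] the weight [exp (- h |F n|)].  For the cover by the
    values at the identity, the sets [X(U)] are the cylinders over [F n], which
    form a tree since [F] is increasing; by the Folner condition any other cover
    refines a cylinder over [F n] into [exp (o(|F n|))] pieces only, so this
    cover already computes the entropy, which is thus a Hausdorff dimension for
    the weighted tree.  In a tree, the content of sets (the infimum of the
    weights of covers) is strongly subadditive, hence continuous along arbitrary
    increasing unions, which yields a compact [C] of positive content inside a
    Souslin set of positive content.  A closed subset of [C] that is minimal (by
    Zorn's lemma) among those with the same content as [C] has finite
    [h]-dimensional measure: if at some cylinder the content by deeper cylinders
    exceeded the weight of the cylinder, a small piece could be removed without
    lowering the total content.  Its entropy is therefore exactly [h]. *)
Require Import Defs.
From HB Require Import structures.
From mathcomp Require Import all_boot all_order all_algebra.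
From mathcomp Require Import finmap lra.
From mathcomp Require Import all_classical all_reals all_analysis.

Set Implicit Arguments.
Unset Strict Implicit.
Unset Printing Implicit Defensive.

Import Order.TTheory GRing.Theory Num.Theory.
Import numFieldNormedType.Exports.

Local Open Scope classical_set_scope.
Local Open Scope ring_scope.

(** * Sums of nonnegative terms over subsets and images *)

Lemma esum_le_subset (R : realType) (I : choiceType) (A B : set I)
    (a : I -> \bar R) :
  A `<=` B -> (forall i, B i -> 0 <= a i)%E ->
  (\esum_(i in A) a i <= \esum_(i in B) a i)%E.
Proof.
move=> AB a0; rewrite (esumID A B)//.
have -> : B `&` A = A by apply: setIidr.
by rewrite leeDl// esum_ge0// => i [/a0].
Qed.

(** Choosing one preimage of each point of the image turns the left side into a sum over a part of
    [A]. *)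
Lemma esum_image_le (R : realType) (I J : choiceType) (e : I -> J)
    (A : set I) (a : J -> \bar R) :
  (forall i, A i -> 0 <= a (e i))%E ->
  (\esum_(j in e @` A) a j <= \esum_(i in A) a (e i))%E.
Proof.
move=> a0.
have [->|/set0P[i0 _]] := eqVneq A set0; first by rewrite image_set0 !esum_set0.
pose g j := xget i0 [set i | A i /\ e i = j].
have gP j : (e @` A) j -> A (g j) /\ e (g j) = j.
  by move=> [i Ai eij]; rewrite /g; case: xgetP => [k _ //|/(_ i)]; case.
rewrite (eq_esum (b := fun j => a (e (g j)))); last by move=> j /gP[_ ->].
rewrite -(esum_image _ g (a \o e)); last first.
  by move=> j k /set_mem/gP[_ {2}<-] /set_mem/gP[_ {2}<-] ->.
by apply: esum_le_subset => // _ [j /gP[+ _] <-].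
Qed.

(** * Content of sets in a weighted tree *)

Section net_content.
Context (R : realType) (X : Type) (T : choiceType).
Context (c : nat -> X -> T) (w : nat -> R).
Hypothesis c_refine : forall n x y, c n.+1 x = c n.+1 y -> c n x = c n y.
Hypothesis c_finite : forall n, finite_set (range (c n)).
Hypothesis w_ge0 : forall n, 0 <= w n.

(** A node records its level, since different levels may share codes. *)
Definition cyl (q : nat * T) : set X := [set x | c q.1 x = q.2].

(** Asking for nonempty cylinders leaves finitely many nodes at each level even when [T] is
    infinite. *)
Definition nodes (N : nat) : set (nat * T) :=
  [set q | (N <= q.1)%N /\ cyl q !=set0].

Definition cost (L : set (nat * T)) : \bar R := \esum_(q in L) (w q.1)%:E.

Definition cylU (L : set (nat * T)) : set X := \bigcup_(q in L) cyl q.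

Definition covering (N : nat) (Z : set X) (L : set (nat * T)) : Prop :=
  L `<=` nodes N /\ Z `<=` cylU L.

(** The Hausdorff content at scale [N]; its supremum over [N] is the analogue of Hausdorff
    measure. *)
Definition content (N : nat) (Z : set X) : \bar R :=
  ereal_inf (cost @` covering N Z).

Lemma c_refine_le m n x y : (m <= n)%N -> c n x = c n y -> c m x = c m y.
Proof.
move=> /subnK <-; elim: (n - m)%N => //= k IHk.
by rewrite addSn => /c_refine/IHk.
Qed.

Lemma cyl_nested p q x : cyl p x -> cyl q x -> (p.1 <= q.1)%N ->
  cyl q `<=` cyl p.
Proof.
rewrite /cyl /= => px qx pq y qy.
by rewrite -px; apply: (c_refine_le pq); rewrite qx.
Qed.

Lemma cyl_inj p q x : cyl p x -> cyl q x -> p.1 = q.1 -> p = q.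
Proof.
by case: p q => [n t] [m u]; rewrite /cyl /= => + + nm; rewrite nm => -> ->.
Qed.

Lemma node_of N n x : (N <= n)%N -> nodes N (n, c n x).
Proof. by move=> Nn; split => //; exists x. Qed.

Lemma nodes_le M N : (M <= N)%N -> nodes N `<=` nodes M.
Proof. by move=> MN q [Nq q0]; split => //; exact: leq_trans Nq. Qed.

Lemma finite_level n (L : set (nat * T)) : (forall q, L q -> q.1 = n) ->
  (forall q, L q -> cyl q !=set0) -> finite_set L.
Proof.
move=> Ln L0; apply: sub_finite_set (finite_image (pair n) (c_finite n)).
move=> [m t] Lq; move: (Ln _ Lq) (L0 _ Lq); rewrite /cyl /= => -> [x /= <-].
by exists (c n x) => //; exists x.
Qed.

Lemma cost_ge0 L : (0 <= cost L)%E.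
Proof. by apply: esum_ge0 => q _; rewrite lee_fin. Qed.

Lemma cost_mono L L' : L `<=` L' -> (cost L <= cost L')%E.
Proof. by move=> LL'; apply: esum_le_subset => // q _; rewrite lee_fin. Qed.

Lemma cost_split B L : cost L = (cost (L `&` B) + cost (L `&` ~` B))%E.
Proof. by apply: esumID => q _; rewrite lee_fin. Qed.

Lemma cost_setU L L' : (cost (L `|` L') <= cost L + cost L')%E.
Proof.
rewrite (cost_split L); apply: leeD; apply: cost_mono.
  by move=> q [].
by move=> q [[]].
Qed.

Lemma cost1 q : cost [set q] = (w q.1)%:E.
Proof. by rewrite /cost esum_set1// lee_fin. Qed.

Lemma content_le N Z L : covering N Z L -> (content N Z <= cost L)%E.
Proof. by move=> ZL; apply: ereal_inf_lbound; exists L. Qed.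

Lemma le_content N Z a : (forall L, covering N Z L -> a <= cost L)%E ->
  (a <= content N Z)%E.
Proof. by move=> aL; apply: le_ereal_inf_tmp => _ [L ZL <-]; exact: aL. Qed.

Lemma content_lt N Z a : (content N Z < a)%E ->
  exists2 L, covering N Z L & (cost L < a)%E.
Proof. by move=> /ereal_inf_lt[_ [L ZL <-] ?]; exists L. Qed.

Lemma content_ge0 N Z : (0 <= content N Z)%E.
Proof. by apply: le_content => L _; exact: cost_ge0. Qed.

Lemma covering_sub N Z Z' L : Z `<=` Z' -> covering N Z' L -> covering N Z L.
Proof. by move=> ZZ' [LN Z'L]; split => //; exact: subset_trans Z'L. Qed.

Lemma content_mono N Z Z' : Z `<=` Z' -> (content N Z <= content N Z')%E.
Proof. by move=> ZZ'; apply: le_content => L /(covering_sub ZZ')/content_le. Qed.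

Lemma content_level M N Z : (M <= N)%N -> (content M Z <= content N Z)%E.
Proof.
move=> MN; apply: le_content => L [LN ZL]; apply: content_le; split => //.
exact: subset_trans (nodes_le MN).
Qed.

Lemma content_fin_num N Z : content N Z \is a fin_num.
Proof.
rewrite ge0_fin_numE ?content_ge0//.
pose L := [set (N, t) | t in range (c N)].
have LZ : covering N Z L.
  split; first by move=> _ [_ [x _ <-] <-]; exact: node_of.
  by move=> x _; exists (N, c N x) => //; exists (c N x) => //; exists x.
apply: le_lt_trans (content_le LZ) _.
have finL : finite_set L by exact: finite_image.
rewrite /cost esum_fset// ?fsbig_finite//; last by move=> *; rewrite lee_fin.
by rewrite sumEFin ltry.
Qed.

Lemma content0 N : content N set0 = 0%E.
Proof.
apply/eqP; rewrite eq_le content_ge0 andbT.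
have <- : cost set0 = 0%E by rewrite /cost esum_set0.
by apply: content_le; split.
Qed.

Lemma content_setU N Z Z' :
  (content N (Z `|` Z') <= content N Z + content N Z')%E.
Proof.
apply/lee_addgt0Pr => e e0.
have [|L ZL cL] := @content_lt N Z (content N Z + (e / 2)%:E)%E.
  by rewrite lteDl ?content_fin_num// lte_fin divr_gt0.
have [|L' ZL' cL'] := @content_lt N Z' (content N Z' + (e / 2)%:E)%E.
  by rewrite lteDl ?content_fin_num// lte_fin divr_gt0.
have LL' : covering N (Z `|` Z') (L `|` L').
  case: ZL ZL' => [LN ZL] [LN' ZL']; split; first by rewrite subUset.
  by rewrite /cylU bigcup_setU; apply: setUSS.
apply: (le_trans (content_le LL')); apply: (le_trans (cost_setU _ _)).
apply: (le_trans (leeD (ltW cL) (ltW cL'))).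
by rewrite addeACA -EFinD -splitr.
Qed.

Lemma content_cyl N q : nodes N q -> (content N (cyl q) <= (w q.1)%:E)%E.
Proof.
move=> Nq; rewrite -cost1; apply: content_le; split; first by move=> _ ->.
by move=> x qx; exists q.
Qed.

Lemma content_cylU N Z L : finite_set L ->
  (forall q, L q -> content N (Z `&` cyl q) <= (w q.1)%:E)%E ->
  (content N (Z `&` cylU L) <= cost L)%E.
Proof.
move=> /finite_fsetP[D ->] {L} LZ; rewrite /cost esum_fset//=; last first.
  by move=> *; rewrite lee_fin.
rewrite -fsbig_seq//= /cylU.
suff H (s : seq (nat * T)) :
    {in s, forall q, content N (Z `&` cyl q) <= (w q.1)%:E}%E ->
    (content N (Z `&` \bigcup_(q in [set` s]) cyl q) <=
      \sum_(q <- s) (w q.1)%:E)%E.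
  by apply: (H (D : seq _)) => q; exact: LZ.
elim: s => [|q s IHs] sw.
  by rewrite big_nil set_nil bigcup_set0 setI0 content0.
rewrite big_cons (_ : [set` q :: s] = q |` [set` s]); last first.
  apply/seteqP; split=> p /=; rewrite inE.
    by case/orP => [/eqP|]; [left|right].
  by case=> [->|->]; rewrite ?eqxx ?orbT.
rewrite bigcup_setU1 setIUr.
apply: (le_trans (content_setU _ _ _)); apply: leeD; first by rewrite sw ?mem_head.
by apply: IHs => p ps; rewrite sw// inE ps orbT.
Qed.

(* Strong subadditivity: of two overlapping cylinders, the larger one is used
   for the union and the smaller one for the intersection.  [cover_above] is
   the part of [L] lying in [cyl q'] for some [q'] in [L'], [cover_sabove] the
   part of [L'] strictly below [L], so that a common node goes to one side only. *)
Definition cover_above (L L' : set (nat * T)) : set (nat * T) :=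
  [set q | exists q', [/\ L' q', (q'.1 <= q.1)%N & cyl q `<=` cyl q']].

Definition cover_sabove (L L' : set (nat * T)) : set (nat * T) :=
  [set q | exists q', [/\ L q', (q'.1 < q.1)%N & cyl q `<=` cyl q']].

Definition cover_join (L L' : set (nat * T)) : set (nat * T) :=
  (L `&` ~` cover_above L L') `|` (L' `&` ~` cover_sabove L L').

Definition cover_meet (L L' : set (nat * T)) : set (nat * T) :=
  (L `&` cover_above L L') `|` (L' `&` cover_sabove L L').

Lemma cost_join_meet L L' :
  (cost (cover_join L L') + cost (cover_meet L L') <= cost L + cost L')%E.
Proof.
apply: (le_trans (leeD (cost_setU _ _) (cost_setU _ _))).
rewrite (cost_split (cover_above L L') L) (cost_split (cover_sabove L L') L').
by rewrite addeACA (addeC (cost (L `&` ~` _))) (addeC (cost (L' `&` ~` _))).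
Qed.

Lemma covering_meet N Z Z' L L' : covering N Z L -> covering N Z' L' ->
  covering N (Z `&` Z') (cover_meet L L').
Proof.
move=> [LN ZL] [LN' ZL']; split.
  by move=> q [[/LN]|[/LN']].
move=> x [/ZL[q Lq qx] /ZL'[q' Lq' qx']].
have [qq'|qq'] := leqP q'.1 q.1.
  exists q => //; left; split => //; exists q'; split => //.
  exact: cyl_nested qx' qx _.
exists q' => //; right; split => //; exists q; split => //.
exact: cyl_nested qx qx' (ltnW _).
Qed.

Lemma cover_join_nodes N L L' : L `<=` nodes N -> L' `<=` nodes N ->
  cover_join L L' `<=` nodes N.
Proof. by move=> LN LN' q [[/LN]|[/LN']]. Qed.

(** Moving up through nodes at [x] ends at one with nothing of [L] or [L'] strictly above it. The
    join keeps that node, from [L'] if it lies in both. *)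
Lemma cover_join_up L L' q x : (L `|` L') q -> cyl q x ->
  exists2 p, cover_join L L' p & cyl p x /\ (p.1 <= q.1)%N.
Proof.
have [n] := ubnP q.1; elim: n q => // n IHn q qn LL'q qx.
have [[p [LL'p pq px]]|noanc] :=
    pselect (exists p, [/\ (L `|` L') p, (p.1 < q.1)%N & cyl p x]).
  have [|r Jr [rx rp]] := IHn p _ LL'p px; first exact: leq_trans pq _.
  by exists r => //; split => //; exact: leq_trans rp (ltnW _).
have [L'q|L'q] := pselect (L' q).
  exists q => //; right; split => // -[p [Lp pq /(_ x qx) px]].
  by apply: noanc; exists p; split => //; left.
case: LL'q => // Lq; exists q => //; left; split => // -[p [L'p pq /(_ x qx) px]].
move: pq; rewrite leq_eqVlt => /orP[/eqP pq|pq].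
  by apply: L'q; rewrite -(cyl_inj px qx pq).
by apply: noanc; exists p; split => //; right.
Qed.

Lemma covering_join N Z Z' L L' : covering N Z L -> covering N Z' L' ->
  covering N (Z `|` Z') (cover_join L L').
Proof.
move=> [LN ZL] [LN' ZL']; split; first exact: cover_join_nodes.
move=> x ZZ'x.
have [q LL'q qx] : exists2 q, (L `|` L') q & cyl q x.
  by case: ZZ'x => [/ZL|/ZL'] [q ? ?]; exists q => //; [left|right].
by have [p Jp [px _]] := cover_join_up LL'q qx; exists p.
Qed.

Lemma finite_eventually (I : Type) (F : set I) (P : nat -> I -> Prop) :
  finite_set F -> (forall q, F q -> exists i, forall j, (i <= j)%N -> P j q) ->
  exists i, forall q, F q -> P i q.
Proof.
elim/Pchoice: I => I in F P *.
move=> /finite_fsetP[D ->] FP.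
have /choice[g gP] : forall q, exists i, q \in D ->
    forall j, (i <= j)%N -> P j q.
  move=> q; have [/FP[i iP]|nD] := boolP (q \in D); first by exists i.
  by exists 0%N.
exists (\max_(q <- D) g q)%N => q qD; apply: (gP _ qD).
exact: leq_bigmax_seq.
Qed.

Lemma cover_incr (W : nat -> set (nat * T)) (L : nat -> set (nat * T)) x i :
  (forall j, W j.+1 = cover_join (W j) (L j.+1)) ->
  cylU (W i) x -> exists j q, cyl q x /\ forall k, (j <= k)%N -> W k q.
Proof.
move=> WS Wix.
(* The least level [l] that any [W j] uses at [x]: later joins never pass to a deeper node and
   cannot go higher, so they keep this one. *)
pose P l := `[< exists j q, [/\ W j q, cyl q x & q.1 = l] >].
have exP : exists l, P l.
  by case: Wix => q Wq qx; exists q.1; apply/asboolP; exists i, q.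
case: (ex_minnP exP) => l /asboolP[j [q [Wjq qx ql]]] minl.
exists j, q; split => // k /subnK <-; elim: (k - j)%N => //= m IHm.
have [] := @cover_join_up (W (m + j)%N) (L (m + j).+1) q x _ qx.
  by left.
move=> p; rewrite -WS => Wp [px pq].
suff <- : p = q by [].
apply: (cyl_inj px qx); apply/eqP; rewrite eqn_leq pq /= ql; apply: minl.
by apply/asboolP; exists (m + j).+1, p.
Qed.

(** Fatou's lemma for sums: each finite part of [V] lies in a single [W i]. *)
Lemma cost_liminf (W : nat -> set (nat * T)) (V : set (nat * T)) b :
  (forall q, V q -> exists i, forall j, (i <= j)%N -> W j q) ->
  (forall i, cost (W i) <= b)%E -> (cost V <= b)%E.
Proof.
move=> VW Wb; apply: ge_ereal_sup => _ [F [finF FV] <-].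
have [i FW] := finite_eventually finF (fun q Fq => VW q (FV q Fq)).
apply: le_trans (Wb i); apply: esum_ge.
by exists F.
Qed.

(** Near-optimal covers [L i] are joined successively into [W i]. The meet of [W i] with the next
    cover still covers [Z i], so by strong subadditivity the excess of the cost over the content
    grows only by the error of the new cover. *)
Lemma content_bigcup_incr N (Z : nat -> set X) (d : R) :
  (forall i, Z i `<=` Z i.+1) -> (forall i, content N (Z i) <= d%:E)%E ->
  (content N (\bigcup_i Z i) <= d%:E)%E.
Proof.
move=> Zincr Zd; apply/lee_addgt0Pr => e e0.
pose a i := fine (content N (Z i)).
have aE i : content N (Z i) = (a i)%:E by rewrite fineK// content_fin_num.
pose b i : R := e * (1 / 2) ^+ i.
have /choice[L LP] : forall i, exists L,
    covering N (Z i) L /\ (cost L <= (a i + b i.+1)%:E)%E.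
  move=> i; have [|L ZL /ltW cL] := @content_lt N (Z i) (a i + b i.+1)%:E.
    by rewrite aE lte_fin ltrDl mulr_gt0// exprn_gt0.
  by exists L.
pose W := fix W i := if i is j.+1 then cover_join (W j) (L i) else L 0%N.
have ZW i : covering N (Z i) (W i).
  elim: i => [|i IHi] /=; first by have [] := LP 0%N.
  apply: covering_sub (covering_join IHi (LP i.+1).1) => x ?; by right.
(* [e - b i.+1] is the sum of the errors [b j.+1] over [j <= i]. *)
have costW i : (cost (W i) <= (a i + (e - b i.+1))%:E)%E.
  elim: i => [|i IHi].
    have [_ /le_trans] := LP 0%N; apply; rewrite lee_fin lerD2l /b expr1.
    by rewrite lerBrDr -mulrDr -splitr mulr1.
  have aM : ((a i)%:E <= cost (cover_meet (W i) (L i.+1)))%E.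
    rewrite -aE; apply: content_le.
    apply: covering_sub (covering_meet (ZW i) (LP i.+1).1) => x Zx.
    by split => //; exact: Zincr.
  rewrite -(@leeD2rE _ (a i)%:E)//.
  apply: (le_trans (leeD2l _ aM)).
  apply: (le_trans (cost_join_meet _ _)).
  apply: (le_trans (leeD IHi (LP i.+1).2)).
  rewrite -!EFinD lee_fin.
  have -> : b i.+1 = b i.+2 + b i.+2.
    by rewrite /b (exprS _ i.+1); lra.
  by lra.
(* Under successive joins the node of [W i] at a point only moves up the tree,
   so it stabilizes and the limit cover loses no point. *)
pose V := [set q | exists i, forall j, (i <= j)%N -> W j q].
apply: (@le_trans _ _ (cost V)).
  apply: content_le; split.
    by move=> q [i /(_ i (leqnn i))]; exact: (ZW i).1.
  move=> x [i _ /(ZW i).2 /(cover_incr (L := L))].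
  by case=> // j [q [qx Wq]]; exists q => //; exists j.
apply: (@cost_liminf W) => // i; apply: (le_trans (costW i)).
rewrite -EFinD lee_fin lerD//; first by rewrite -lee_fin -aE.
by rewrite gerBl mulr_ge0 ?exprn_ge0// ltW.
Qed.

(** Compactness tested on covers by cylinders, which makes sense in the bare tree. *)
Definition net_compact (C : set X) : Prop := forall L, C `<=` cylU L ->
  exists2 D : {fset nat * T}, [set` D] `<=` L & C `<=` cylU [set` D].

(** The alternative [set0] accounts for an empty chain. *)
Lemma chain_fset (F : set (set (nat * T))) (s : seq (nat * T)) :
  total_on F subset ->
  exists2 I, I = set0 \/ F I &
    forall q, q \in s -> (\bigcup_(J in F) J) q -> I q.
Proof.
move=> totF; elim: s => [|p s [I FI sI]]; first by exists set0 => //; left.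
have [[J FJ Jp]|Fp] := pselect ((\bigcup_(J in F) J) p); last first.
  by exists I => // q; rewrite inE => /orP[/eqP ->//|]; exact: sI.
have [IJ|JI] : I `<=` J \/ J `<=` I.
- by case: FI => [->|FI]; [left|exact: totF].
- exists J; first by right.
  by move=> q; rewrite inE => /orP[/eqP ->//|qs Fq]; apply/IJ/sI.
- exists I => // q; rewrite inE => /orP[/eqP -> _|]; first exact: JI.
  exact: sI.
Qed.

(** Zorn's lemma on the set [I] of removed nodes. For a chain, a cover [L] of what its union leaves,
    together with that union, covers [C]. By compactness finitely many nodes suffice, and those from
    the chain lie in one member [I]; so [L] already covers [C] without [cylU I]. *)
Lemma maximal_removal N (C : set X) : net_compact C ->
  exists2 I, (content N C <= content N (C `\` cylU I))%E &
    forall q, (C `\` cylU I) `&` cyl q !=set0 ->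
      (content N ((C `\` cylU I) `\` cyl q) < content N C)%E.
Proof.
move=> cC.
pose P := [set I | (content N C <= content N (C `\` cylU I))%E].
have P0 : P set0 by rewrite /P /= /cylU bigcup_set0 setD0.
have [|I [PI Imax]] := @Zorn_bigcup _ P.
  move=> F FP totF; apply: le_content => L [LN CL].
  have [|D DL CD] := cC (L `|` \bigcup_(J in F) J).
    move=> x Cx; rewrite /cylU bigcup_setU.
    by have [?|?] := pselect (cylU (\bigcup_(J in F) J) x); [right|left; exact: CL].
  have [I FI DI] := chain_fset D totF.
  have PI : P I by case: FI => [->|/FP].
  apply: le_trans PI _; apply: content_le; split => // x [/CD[q Dq qx] nIx].
  have [Lq|Fq] := DL _ Dq; first by exists q.
  by case: nIx; exists q => //; exact: DI.
(* A point left in [cyl q] shows that [q] is not in [I], so adding it contradicts maximality. *)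
exists I => // q [x [[Cx nIx] qx]]; rewrite ltNge; apply/negP => Pq.
apply: (Imax (q |` I)).
  split => [p ?|/(_ q (or_introl erefl)) Iq]; first by right.
  by apply: nIx; exists q.
by move: Pq; rewrite setDDl /P /= {2}/cylU bigcup_setU1 setUC.
Qed.

Lemma subset_finite_content N (C : set X) :
  (forall e m, 0 < e -> exists2 n, (m <= n)%N & w n <= e) -> net_compact C ->
  exists2 E, E `<=` C & (content N C <= content N E)%E /\
    forall k, (content k E <= content N E)%E.
Proof.
move=> w_small /(maximal_removal N)[I]; set E := C `\` cylU I => CE Emin.
exists E; first by move=> x [].
split => // k.
have [kN|/ltnW/subnK <-] := leqP k N; first exact: content_level.
elim: (k - N)%N => // {}k IHk; apply: le_trans IHk; rewrite addSn.
have : (N <= k + N)%N by rewrite leq_addl.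
move: (k + N)%N => {}k Nk; rewrite leNgt; apply/negP => /content_lt[L [Lk EL] cL].
pose Lk0 := L `&` [set q | q.1 = k].
(* Otherwise the nodes of [L] at level [k] could be traded for deeper ones at no extra cost, and
   [cost L] would bound the content at level [k.+1]. *)
have [q Lq wq] : exists2 q, Lk0 q &
    ((w k)%:E < content k.+1 (E `&` cyl q))%E.
  apply: contrapT => /forall2NP noq.
  have finLk : finite_set Lk0.
    by apply: (@finite_level k) => q [Lq] // _; exact: (Lk _ Lq).2.
  have c1 : (content k.+1 (E `&` cylU Lk0) <= cost Lk0)%E.
    apply: content_cylU => // q Lq; rewrite leNgt Lq.2.
    by case: (noq q) => // /negP.
  have c2 : (content k.+1 (cylU (L `&` ~` [set q | q.1 = k])) <=
      cost (L `&` ~` [set q | q.1 = k]))%E.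
    apply: content_le; split => // q [/Lk[kq q0] /eqP nqk]; split => //.
    by rewrite ltn_neqAle eq_sym nqk.
  move: cL; rewrite ltNge (cost_split [set q | q.1 = k]) => /negP; apply.
  apply: le_trans (leeD c1 c2); apply: le_trans (content_setU _ _ _).
  apply: content_mono => x Ex; have [q Lq qx] := EL _ Ex.
  have [qk|qk] := eqVneq q.1 k; first by left; split => //; exists q.
  by right; exists q => //; split => //; apply/eqP.
have [{}Lq qk] := Lq.
have Nq : nodes N q by apply: nodes_le (Lk _ Lq).
pose v := fine (content k.+1 (E `&` cyl q)).
have vE : content k.+1 (E `&` cyl q) = v%:E by rewrite fineK// content_fin_num.
move: wq; rewrite vE lte_fin -subr_gt0 => v0.
(* The cylinder to be removed must weigh no more than the excess [v - w k]. *)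
have [n kn wn] := w_small _ k.+1 v0.
have [x [Ex qx]] : E `&` cyl q !=set0.
  apply/set0P/eqP => E0; move: v0.
  rewrite subr_gt0 -lte_fin -vE E0 content0 lte_fin ltNge.
  by rewrite w_ge0.
pose r := (n, c n x).
have rx : cyl r x by [].
have rq : cyl r `<=` cyl q by apply: cyl_nested qx rx _; rewrite /= qk ltnW.
have [|M [NM EM] cM] := content_lt (Emin r _).
  by exists x.
have cNE L' : covering N E L' -> (content N C <= cost L')%E.
  by move=> /content_le; exact: le_trans.
(* Such a [p] contains [cyl q], hence the removed [cyl r], so [M] would cover all of [E] for less
   than the content of [C]. *)
have [[p [Mp pk [y [py qy]]]]|nop] :=
    pselect (exists p, [/\ M p, (p.1 <= k)%N & cyl p `&` cyl q !=set0]).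
  move: cM; rewrite ltNge => /negP; apply; apply: cNE; split => // z Ez.
  have [rz|rz] := pselect (cyl r z); last exact: EM.
  by exists p => //; apply: (cyl_nested py qy); [rewrite qk|exact: rq].
(* Otherwise the part of [M] inside [cyl q] costs at least [w k], so that the
   single node [q] can replace it and [E] itself is covered too cheaply. *)
pose A := [set p | cyl p `&` cyl q !=set0].
have MA p : (M `&` A) p -> (k < p.1)%N.
  by move=> [Mp Ap]; rewrite ltnNge; apply/negP => pk; apply: nop; exists p.
have wkMA : ((w k)%:E <= cost (M `&` A))%E.
  rewrite -(@leeD2rE _ (w n)%:E)// -EFinD.
  apply: (@le_trans _ _ v%:E); first by rewrite lee_fin addrC -lerBrDr.
  rewrite -vE.
  have Nr : nodes k.+1 r by exact: node_of.
  apply: le_trans (leeD2l _ (content_cyl Nr)).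
  have cMA : covering k.+1 (E `&` cyl q `\` cyl r) (M `&` A).
    split.
      by move=> p MAp; split; [exact: MA|exact: (NM _ MAp.1).2].
    move=> y [[Ey qy] ry]; have [p Mp py] := EM y (conj Ey ry).
    by exists p => //; split => //; exists y.
  apply: le_trans (leeD2r _ (content_le cMA)).
  apply: le_trans (content_setU _ _ _); apply: content_mono => y Ey.
  by have [?|?] := pselect (cyl r y); [right|left].
have : (content N C <= cost ((M `&` ~` A) `|` [set q]))%E.
  apply: cNE; split; first by move=> p [[/NM]|->].
  move=> y Ey; have [qy|qy] := pselect (cyl q y); first by exists q => //; right.
  have [|p Mp py] := EM y; first by split => // /rq.
  exists p => //; left; split => // Ap; apply: qy; case: (Ap) => z [pz qz].
  by apply: (cyl_nested qz pz) py; rewrite qk ltnW// MA.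
rewrite leNgt => /negP; apply; apply: le_lt_trans cM.
apply: (le_trans (cost_setU _ _)); rewrite cost1 (cost_split A M) addeC qk.
exact: leeD2r.
Qed.

(** Coordinates are bounded one at a time: the sets obtained by bounding the next one by [m]
    increase with [m] to the current set, so by [content_bigcup_incr] one of them keeps its content
    above [d]. *)
Lemma content_baire (f : (nat -> nat) -> X) N (d : R) :
  (d%:E < content N (range f))%E ->
  exists b : nat -> nat, forall k,
    (d%:E < content N (f @` [set s | forall i, (i < k)%N -> (s i <= b i)%N]))%E.
Proof.
move=> fd.
pose box (u : seq nat) :=
  [set s : nat -> nat | forall i, (i < size u)%N -> (s i <= nth 0%N u i)%N].
have /choice[g gP] : forall u, exists m, (d%:E < content N (f @` box u))%E ->
    (d%:E < content N (f @` box (rcons u m)))%E.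
  move=> u; apply: contrapT => /forallNP nom.
  have du : (d%:E < content N (f @` box u))%E.
    by apply: contrapT => ndu; apply: (nom 0%N).
  move: du; rewrite ltNge => /negP; apply.
  have -> : f @` box u = \bigcup_m (f @` box (rcons u m)).
    apply/seteqP; split => [_ [s us <-]|_ [m _ [s us <-]]].
      exists (s (size u)) => //; exists s => // i.
      rewrite size_rcons ltnS leq_eqVlt => /orP[/eqP ->|iu].
        by rewrite nth_rcons ltnn eqxx.
      by rewrite nth_rcons iu; exact: us.
    exists s => // i iu; have := us i; rewrite size_rcons nth_rcons iu.
    by apply; exact: ltnW.
  apply: content_bigcup_incr => [m _ [s us <-]|m].
    exists s => // i iu; apply: leq_trans (us i _) _.
      by move: iu; rewrite !size_rcons.
    by rewrite !nth_rcons; case: ifP => // _; case: ifP.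
  by rewrite leNgt; apply/negP => dm; exact: (nom m).
pose u := fix u k := if k is j.+1 then rcons (u j) (g (u j)) else [::].
have su k : size (u k) = k by elim: k => //= k IHk; rewrite size_rcons IHk.
have du k : (d%:E < content N (f @` box (u k)))%E.
  elim: k => [|k IHk]; last exact: gP.
  by apply: (lt_le_trans fd); apply: content_mono => _ [s _ <-]; exists s.
exists (fun i => g (u i)) => k.
suff ub i : (i < k)%N -> nth 0%N (u k) i = g (u i).
  apply: (lt_le_trans (du k)); apply: content_mono => _ [s us <-].
  by exists s => // i ik; rewrite -ub//; apply: us; rewrite su.
elim: k => // k IHk; rewrite ltnS leq_eqVlt /= nth_rcons su => /orP[/eqP ->|ik].
  by rewrite ltnn eqxx.
by rewrite ik IHk.
Qed.

End net_content.

(** * Compactness and products of discrete spaces *)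

(* Unlike [compact_cover], this does not need a pointed space. *)
Lemma compact_cover_compact (Y : topologicalType) (B : set Y) :
  compact B -> cover_compact B.
Proof.
move=> cB I D f fo BD; apply: contrapT => nofin.
(* Without a finite subcover these sets form a proper filter. Its cluster point lies in some [f i],
   although the complement of [f i] belongs to the filter. *)
pose Phi : set_system Y := [set Q |
  exists2 s : {fset I}, {subset s <= D} & B `\` \bigcup_(i in [set` s]) f i `<=` Q].
have FPhi : ProperFilter Phi.
  apply: Build_ProperFilter_ex => [Q [s sD sQ]|].
    apply: contrapT => Q0; apply: nofin; exists s => // x Bx.
    apply: contrapT => nx; apply: Q0; exists x; exact: sQ.
  split; first by exists fset0.
    move=> Q Q' [s sD sQ] [s' sD' sQ']; exists (s `|` s')%fset.
      by move=> i; rewrite inE => /orP[/sD|/sD'].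
    move=> x [Bx nx]; split; [apply: sQ|apply: sQ'].
      by split => // -[i si fi]; apply: nx; exists i => //=; rewrite inE si.
    by split => // -[i si fi]; apply: nx; exists i => //=; rewrite inE si orbT.
  by move=> Q Q' QQ' [s sD sQ]; exists s => // x /sQ/QQ'.
have [|x [Bx clx]] := cB _ FPhi; first by exists fset0 => // x [].
have [i Di fi] := BD x Bx.
have [||y [nfi]] := clx (~` f i) (f i).
- exists [fset i]%fset; first by move=> j; rewrite inE => /eqP ->; exact: mem_set.
  by move=> y [By ny] fiy; apply: ny; exists i => //=; rewrite inE.
- by apply: open_nbhs_nbhs; split => //; exact: fo.
- exact: nfi.
Qed.

Lemma ptws_open_agree (I : eqType) (V : discreteTopologicalType)
    (x : {ptws I -> V}) (s : seq I) :
  open [set y : {ptws I -> V} | forall i, i \in s -> y i = x i].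
Proof.
elim: s => [|i s IHs].
  by rewrite (_ : mkset _ = setT); [exact: openT|apply/seteqP; split].
rewrite (_ : mkset _ = (@proj I (fun=> V) i @^-1` [set x i]) `&`
    [set y | forall i, i \in s -> y i = x i]); last first.
  apply/seteqP; split => y /=.
    move=> yx; split; first by rewrite /proj yx ?mem_head.
    by move=> j js; rewrite yx// inE js orbT.
  by move=> [yi ys] j; rewrite inE => /orP[/eqP ->|/ys].
apply: openI => //; apply: open_comp; last exact: discrete_open.
by move=> y _; exact: proj_continuous.
Qed.

Lemma ptws_nbhs_agree (I : choiceType) (V : discreteTopologicalType)
    (x : {ptws I -> V}) (P : set {ptws I -> V}) :
  nbhs x P ->
  exists D : {fset I}, forall y, (forall i, i \in D -> y i = x i) -> P y.
Proof.
pose Phi : set_system {ptws I -> V} :=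
  [set Q | exists D : {fset I}, forall y, (forall i, i \in D -> y i = x i) -> Q y].
have FPhi : Filter Phi.
  split; first by exists fset0.
    move=> Q Q' [D QD] [D' QD']; exists (D `|` D')%fset => y yD; split.
      by apply: QD => i iD; apply: yD; rewrite inE iD.
    by apply: QD' => i iD; apply: yD; rewrite inE iD orbT.
  by move=> Q Q' QQ' [D QD]; exists D => y /QD/QQ'.
(* The product topology is a supremum of topologies pulled back from the coordinates, so convergence
   is checked one coordinate at a time. *)
suff : Phi --> x by move=> /(_ P)/[apply].
apply/cvg_sup => i Q [_ [[W _ <-] Wx] WQ].
by exists [fset i]%fset => y yi; apply: WQ; rewrite /= yi ?inE.
Qed.

Lemma compact_box (b : nat -> nat) :
  compact [set s : {ptws nat -> nat} | forall i, (s i <= b i)%N].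
Proof.
apply: (@tychonoff nat (fun=> nat) (fun i => [set n | (n <= b i)%N])) => i.
apply: finite_compact; apply: sub_finite_set (finite_II (b i).+1).
by move=> n.
Qed.

(** Finitely many cylinders inside [O] cover the compact box; [k] is the largest of their
    lengths. *)
Lemma open_box (O : set {ptws nat -> nat}) (b : nat -> nat) : open O ->
  (forall s, (forall i, (s i <= b i)%N) -> O s) ->
  exists k, forall s, (forall i, (i < k)%N -> (s i <= b i)%N) -> O s.
Proof.
move=> oO bO.
pose K k (s : {ptws nat -> nat}) :=
  [set t : {ptws nat -> nat} | forall i, i \in iota 0 k -> t i = s i].
pose J := [set p : nat * {ptws nat -> nat} | K p.1 p.2 `<=` O].
have := compact_cover_compact (@compact_box b).
case/(_ _ J (fun p => K p.1 p.2)) => [p _|s sb|D DJ bD].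
- exact: ptws_open_agree.
- have [D sD] := ptws_nbhs_agree (open_nbhs_nbhs (conj oO (bO _ sb))).
  exists ((\max_(i <- D) i).+1, s) => //= t ts; apply: sD => i iD; apply: ts.
  by rewrite mem_iota ltnS /= leq_bigmax_seq.
exists (\max_(p <- D) p.1) => s sb.
(* Zeroing the tail puts the point in the box and keeps every coordinate the cylinders look at. *)
pose t i := if (i < \max_(p <- D) p.1)%N then s i else 0%N.
have [|p pD pt] := bD t; first by move=> i; rewrite /t; case: ifP => // /sb.
have /set_mem := DJ _ pD; apply => i ip; rewrite -pt// /t ifT//.
apply: leq_trans (leq_bigmax_seq _ pD _) => //.
by move: ip; rewrite mem_iota.
Qed.

Lemma set_type_cover_compact (Y : topologicalType) (B : set Y) :
  compact B -> cover_compact [set: set_type B].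
Proof.
move=> /compact_cover_compact cB I D f fo Df.
have /choice[g gP] : forall i, exists V : set Y, D i -> open V /\ set_val @^-1` V = f i.
  move=> i; have [/fo[V oV Vf]|nD] := pselect (D i); first by exists V.
  by exists set0.
move: cB => /(_ _ D g)[i /gP[]//|y By|D' D'D BD'].
  have [|i Di fi] := Df (SigSub (mem_set By)); first by [].
  by exists i => //; move: fi; rewrite -(gP _ Di).2.
exists D' => // x _; have [i iD' gi] := BD' _ (set_valP x).
by exists i => //; rewrite -(gP _ (set_mem (D'D _ iD'))).2.
Qed.

(** * Folner sequences *)

Section folner_facts.
Context (R : realType) (G : groupType) (F : nat -> {fset G}).
Hypothesis Ffolner : is_folner R F.

(** Coordinate [d] of [g x] is coordinate [d * g] of [x], so these are the coordinates outside [E]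
    seen through the window [D] from points of [E]. *)
Definition boundary (D E : {fset G}) : {fset G} :=
  ([fset (d * g)%g | d in D, g in E] `\` E)%fset.

Lemma card_F_gt0 n : (0 < #|` F n|)%N.
Proof. by rewrite cardfs_gt0 (proj1 Ffolner). Qed.

Lemma card_boundary (D E : {fset G}) :
  (#|` boundary D E| <= \sum_(d <- D) #|` fsymdiff E (ltrans d E)|)%N.
Proof.
have -> : (\sum_(d <- D) #|` fsymdiff E (ltrans d E)| =
    size (flatten [seq (fsymdiff E (ltrans d E) : seq G) | d <- D]))%N.
  by rewrite size_flatten sumnE /shape -map_comp big_map.
apply: uniq_leq_size; first exact: fset_uniq.
move=> x; rewrite /boundary inE => /andP[xE /imfset2P[d dD [g gE xdg]]].
apply/flatten_mapP; exists d => //; rewrite /fsymdiff !inE xE /=.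
by apply/orP; right; apply/imfsetP; exists g.
Qed.

Lemma folner_boundary (D : {fset G}) (e : R) : 0 < e ->
  exists J, forall j, (J <= j)%N ->
    (#|` boundary D (F j)|%:R : R) <= e * #|` F j|%:R.
Proof.
move=> e0; pose e' := e / (#|` D|%:R + 1).
(* The sum over [D] multiplies the error by the size of [D]; the added 1 covers an empty [D]. *)
have e'0 : 0 < e' by rewrite divr_gt0// ltr_wpDl.
pose near_inv j d := forall k, (j <= k)%N ->
  (#|` fsymdiff (F k) (ltrans d (F k))|%:R : R) <= e' * #|` F k|%:R.
have [J JD] : exists J, forall d, [set` D] d -> near_inv J d.
  apply: finite_eventually => // d _.
  have /cvgrPdist_le/(_ _ e'0)[i _ iP] := proj2 Ffolner d.
  exists i => j ij k jk; have := iP k (leq_trans ij jk).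
  rewrite sub0r normrN ger0_norm ?divr_ge0//.
  by rewrite ler_pdivrMr// ltr0n card_F_gt0.
exists J => j Jj.
have : (#|` boundary D (F j)|%:R : R) <=
    \sum_(d <- D) (e' * #|` F j|%:R : R).
  apply: (@le_trans _ _ (\sum_(d <- D)
      #|` fsymdiff (F j) (ltrans d (F j))|)%N%:R).
    by rewrite ler_nat card_boundary.
  rewrite natr_sum !big_seq; apply: ler_sum => d dD.
  exact: JD.
move=> /le_trans; apply.
rewrite big_const_seq count_predT iter_addr_0 -[leLHS]mulr_natl mulrA ler_wpM2r//.
rewrite /e' mulrA ler_pdivrMr ?ltr_wpDl// mulrC.
by rewrite ler_wpM2l ?lerDl// ltW.
Qed.

(** Otherwise the sets stabilize at some [F n]. The Folner ratios are then eventually constant,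
    hence 0, so every translate of [F n] equals [F n]; as it contains 1, it is all of [G]. *)
Lemma folner_card_unbounded : infinite_set [set: G] ->
  (1%g : G) \in F 0%N -> (forall n, (F n `<=` F n.+1)%fset) ->
  forall k, exists n, forall m, (n <= m)%N -> (k <= #|` F m|)%N.
Proof.
move=> Ginf F1 Fmono k.
have FS m n : (m <= n)%N -> (F m `<=` F n)%fset.
  move=> /subnK <-; elim: (n - m)%N => //= i IHi.
  exact: fsubset_trans IHi (Fmono _).
suff [n kn] : exists n, (k <= #|` F n|)%N.
  exists n => m nm; apply: leq_trans kn _; exact: fsubset_leq_card (FS _ _ nm).
apply: contrapT => /forallNP nok.
have bnd i : (exists n, #|` F n| == i) -> (i <= k)%N.
  move=> [n /eqP <-]; rewrite leqNgt; apply/negP => kn.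
  by apply: (nok n); exact: ltnW.
pose P i := `[< exists n, #|` F n| == i >].
have [||i /asboolP[n /eqP ni] imax] := @ex_maxnP P k.
- by exists #|` F 0%N|; apply/asboolP; exists 0%N.
- by move=> i /asboolP; exact: bnd.
have Fn m : (n <= m)%N -> F m = F n.
  move=> nm; apply/esym/eqP; rewrite eqEfcard FS//= ni.
  by apply: imax; apply/asboolP; exists m.
apply: Ginf; apply: sub_finite_set (finite_fset (F n)) => s _ /=.
have : ltrans s (F n) = F n.
  have : (#|` fsymdiff (F n) (ltrans s (F n))|%:R / #|` F n|%:R : R) = 0.
    have /cvg_lim <- // := proj2 Ffolner s.
    apply/esym/cvg_lim => //; apply: cvg_near_cst.
    by exists n => // m /= /Fn ->.
  move=> /eqP; rewrite mulf_eq0 invr_eq0 !pnatr_eq0.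
  rewrite [X in _ || X]gtn_eqF ?card_F_gt0// orbF cardfs_eq0.
  by rewrite /fsymdiff fsetU_eq0 !fsetD_eq0 andbC -eqEfsubset => /eqP.
move=> <-; apply/imfsetP; exists 1%g; last by rewrite mulg1.
exact: (fsubsetP (FS 0%N n _)).
Qed.

End folner_facts.

(** * Bowen entropy of subshifts *)

Section patterns.
Context (G : groupType) (A : finType).

Definition pattern (E : {fset G}) (x : full_shift G A) : {fmap G -> A} :=
  [fmap g : E => x (val g)].

Lemma fnd_fmap (E : {fset G}) (f : G -> A) g :
  ([fmap u : E => f (val u)] : {fmap G -> A}).[? g]%fmap =
  if g \in E then Some (f g) else None.
Proof.
case: ifPn => gE; last by rewrite not_fnd.
by rewrite (in_fnd (f := [fmap u : E => f (val u)]) gE) ffunE.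
Qed.

Lemma patternP (E : {fset G}) x y :
  pattern E x = pattern E y <-> forall g, g \in E -> x g = y g.
Proof.
split => [/fmapP xy g gE|xy].
  by have := xy g; rewrite /pattern !fnd_fmap gE => -[].
by apply/fmapP => g; rewrite /pattern !fnd_fmap; case: ifP => // /xy ->.
Qed.

Lemma pattern_fset (E : {fset G}) : exists P : {fset {fmap G -> A}},
  (forall x, pattern E x \in P) /\ (#|` P| <= #|A| ^ #|` E|)%N.
Proof.
exists [fset (FinMap f : {fmap G -> A}) | f : {ffun E -> A} in predT]%fset.
split.
  by move=> x; apply/imfsetP; exists [ffun g : E => x (val g)].
apply: leq_trans (leq_imfset_card _ _ _) _.
by rewrite -cardE card_ffun cardfE.
Qed.

Lemma finite_range_pattern (Y : Type) (i : Y -> full_shift G A) (E : {fset G}) :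
  finite_set (range (fun y => pattern E (i y))).
Proof.
have [P [xP _]] := pattern_fset E.
by apply: sub_finite_set (finite_fset P) => _ [y _ <-]; exact: xP.
Qed.

End patterns.

Lemma esum_mull_le (R : realType) (I : choiceType) (L : set I)
    (a : I -> \bar R) (r : \bar R) :
  (0 <= r)%E -> (forall i, 0 <= a i)%E ->
  (\esum_(i in L) (r * a i) <= r * \esum_(i in L) a i)%E.
Proof.
move=> r0 a0; apply: ge_ereal_sup => _ [D [finD DL] <-].
rewrite -ge0_mule_fsumr//; apply: lee_wpmul2l => //.
by apply: esum_ge; exists D.
Qed.

Section bowen_entropy_facts.
Context (R : realType) (G : groupType) (X : topologicalType).
Context (act : G -> X -> X) (F : nat -> {fset G}).

Lemma bowen_preM_homo K U s : {homo bowen_preM act F K U ^~ s : m n /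
  (m <= n)%N >-> (m <= n :> \bar R)%E}.
Proof.
move=> m n mn; apply: le_ereal_inf => _ [L [LF KL] <-].
exists L => //; split => // w /LF[j /= nj wj].
by exists j => //=; exact: leq_trans nj.
Qed.

Lemma bowen_ME K U (s : R) :
  bowen_M act F K U s = ereal_sup (range (bowen_preM act F K U ^~ s)).
Proof.
apply/cvg_lim => //; apply: ereal_nondecreasing_cvgn.
exact: bowen_preM_homo.
Qed.

Lemma bowen_sum_ge0 (s : R) (L : set {fmap G -> set X}) : (0 <= bowen_sum s L :> \bar R)%E.
Proof. by apply: esum_ge0 => w _; rewrite lee_fin expR_ge0. Qed.

Lemma bowen_preM_ge0 K U N (s : R) : (0 <= bowen_preM act F K U N s)%E.
Proof. by apply: le_ereal_inf_tmp => _ [L _ <-]; exact: bowen_sum_ge0. Qed.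

Lemma bowen_M_eq0 K U (s : R) :
  (forall N e, 0 < e ->
    exists2 n, (N <= n)%N & (bowen_preM act F K U n s <= e%:E)%E) ->
  bowen_M act F K U s = 0%E.
Proof.
move=> small; apply/eqP; rewrite bowen_ME eq_le; apply/andP; split.
  apply: ge_ereal_sup => _ [N _ <-]; apply/lee_addgt0Pr => e e0; rewrite add0e.
  have [n Nn] := small N e e0; apply: le_trans; exact: bowen_preM_homo.
by apply: le_trans (bowen_preM_ge0 K U 0 s) _; apply: ereal_sup_ubound; exists 0%N.
Qed.

Lemma bowen_M0_preM K U (s : R) N :
  bowen_M act F K U s = 0%E -> (bowen_preM act F K U N s <= 0)%E.
Proof. by rewrite bowen_ME => <-; apply: ereal_sup_ubound; exists N. Qed.

End bowen_entropy_facts.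

(** * Bowen entropy and contents in the tree of patterns *)

Section subshift_entropy.
Context (R : realType) (G : groupType) (A : finType) (S : subshift G A).
Context (F : nat -> {fset G}).
Hypothesis Fmono : forall n, (F n `<=` F n.+1)%fset.

Let X : topologicalType := set_type S.
Let act : G -> X -> X := @subshift_act G A S.

Definition code (n : nat) (x : X) : {fmap G -> A} := pattern (F n) (set_val x).

Definition weight (s : R) (n : nat) : R := expR (- s * #|` F n|%:R).

Lemma code_refine n (x y : X) : code n.+1 x = code n.+1 y -> code n x = code n y.
Proof.
move=> /patternP xy; apply/patternP => g gF; apply: xy.
exact: (fsubsetP (Fmono n)).
Qed.

Lemma code_finite n : finite_set (range (code n)).
Proof. exact: finite_range_pattern. Qed.

Lemma weight_ge0 s n : 0 <= weight s n.
Proof. exact: expR_ge0. Qed.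

Lemma set_val_act g (x : X) u : set_val (act g x) u = set_val x (u * g)%g.
Proof. by rewrite /act /subshift_act set_valE. Qed.

Lemma open_coord (g : G) (a : A) : open [set x : X | set_val x g = a].
Proof.
exists (@proj G (fun=> discrete_topology A) g @^-1` [set a]) => //.
apply: open_comp; last exact: discrete_open.
by move=> y _; exact: proj_continuous.
Qed.

Lemma open_cyl q : open (cyl code q).
Proof.
have [->|/set0P[x xq]] := eqVneq (cyl code q) set0; first exact: open0.
have -> : cyl code q = set_val @^-1`
    [set y : full_shift G A | forall g, g \in (F q.1 : seq G) -> y g = set_val x g].
  apply/seteqP; split => y.
    by rewrite /cyl /= -xq => /patternP.
  by rewrite /cyl /= -xq => ?; apply/patternP.
exists [set y : full_shift G A |
  forall g, g \in (F q.1 : seq G) -> y g = set_val x g] => //.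
exact: ptws_open_agree.
Qed.

Definition coord_cover : set (set X) :=
  range (fun a : A => [set x : X | set_val x 1%g = a]).

Lemma coord_coverP : finite_open_cover coord_cover.
Proof.
split.
- apply: finite_image; exact: finite_finset.
- by move=> _ [a _ <-]; exact: open_coord.
- apply/seteqP; split => // x _.
  exists [set y : X | set_val y 1%g = set_val x 1%g] => //.
  by exists (set_val x 1%g).
Qed.

(** Coordinate 1 of [g x] is [x g], so a word over [F j] prescribes all values on [F j]: its set
    lies in one cylinder of the same weight. *)
Lemma content_le_preM (Z : set X) N (s : R) :
  (content code (weight s) N Z <= bowen_preM act F Z coord_cover N s)%E.
Proof.
apply: le_ereal_inf_tmp => _ [L [LF ZL] <-].
(* Words with empty set correspond to no node and are dropped. *)
pose L1 := L `&` [set v | word_set act v !=set0].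
have /choice[e eP] : forall v, exists q : nat * {fmap G -> A}, L1 v ->
    [/\ nodes code N q, domf v = F q.1 & word_set act v `<=` cyl code q].
  move=> v; have [[Lv [x vx]]|nv] := pselect (L1 v); last first.
    by exists (0%N, [fmap]%fmap).
  have [j Nj [vF vU]] := LF _ Lv.
  exists (j, code j x) => _; split => //; first by split => //; exists x.
  move=> y vy; apply/patternP => g; rewrite -[(_, _).1]/j -vF => gv.
  have := vU [` gv]%fset; case=> a _ av.
  have := vy [` gv]%fset I; have := vx [` gv]%fset I.
  by rewrite /= -av /= !set_val_act mul1g => -> ->.
have cov : covering code N Z (e @` L1).
  split; first by move=> _ [v /eP[]] + _ _ <-.
  move=> x /ZL[v Lv vx]; have L1v : L1 v by split => //; exists x.
  by exists (e v); [exists v|have [_ _] := eP v L1v; exact].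
apply: le_trans (content_le (weight s) cov) _; rewrite /cost.
apply: le_trans (@esum_image_le R _ _ e L1 (fun q => (weight s q.1)%:E) _) _.
  by move=> v _; rewrite lee_fin weight_ge0.
rewrite (eq_esum (b := fun v : {fmap G -> set X} =>
  (expR (- s * #|` domf v|%:R))%:E)); last first.
  by move=> v /eP[_ + _]; rewrite /weight => <-.
apply: esum_le_subset; first by move=> v [].
by move=> v _; rewrite lee_fin expR_ge0.
Qed.

Lemma content_weight_le (s t : R) N (Z : set X) : s <= t ->
  (content code (weight t) N Z <= content code (weight s) N Z)%E.
Proof.
move=> st; apply: le_content => L ZL.
apply: le_trans (content_le (weight t) ZL) _.
by apply: le_esum => q _; rewrite lee_fin ler_expR ler_wpM2r// lerN2.
Qed.

Lemma bowen_entropy_ge (Z : set X) N (s : R) :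
  (0 < content code (weight s) N Z)%E -> (s%:E <= bowen_entropy R act F Z)%E.
Proof.
move=> Z0; apply: le_trans (ereal_sup_ubound _); last first.
  by exists coord_cover => //; exact: coord_coverP.
apply: le_ereal_inf_tmp => _ [t [t0 /(bowen_M0_preM N) Mt] <-].
rewrite lee_fin leNgt; apply/negP => ts.
move: Z0; rewrite ltNge => /negP; apply; apply: le_trans Mt.
apply: le_trans (content_le_preM _ _ _); exact: content_weight_le (ltW ts).
Qed.

(** The Lebesgue number of a cover of a compact space, with finite windows in place of radii. *)
Lemma cover_window (U : set (set X)) : finite_open_cover U ->
  exists D : {fset G}, forall x : X, exists2 V, U V &
    forall y : X, (forall g, g \in D -> set_val y g = set_val x g) -> V y.
Proof.
move=> [_ Uopen UT].
have /choice[DV DVP] : forall x : X, exists p : {fset G} * set X, U p.2 /\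
    forall y : X, (forall g, g \in p.1 -> set_val y g = set_val x g) -> p.2 y.
  move=> x; have [V UV Vx] : (\bigcup_(V in U) V) x by rewrite UT.
  have [W oW WV] := Uopen V UV.
  have Wx : W (set_val x) by move: Vx; rewrite -WV.
  have [D DW] := ptws_nbhs_agree (open_nbhs_nbhs (conj oW Wx)).
  exists (D, V); split => //= y yx; rewrite -WV /=; exact: DW.
pose B x := [set y : X |
  forall g, g \in ((DV x).1 : seq G) -> set_val y g = set_val x g].
have cS : compact (S : set (full_shift G A)).
  apply: (@subclosed_compact _ _ setT) => //; first exact: subshift_closed.
  rewrite (_ : setT = [set f : full_shift G A |
      forall g, [set: discrete_topology A] (f g)]).
    apply: (@tychonoff G (fun=> discrete_topology A) (fun=> setT)) => g.
    by apply: finite_compact; exact: finite_finset.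
  by apply/seteqP; split.
have [x _|x _|K _ KT] := @set_type_cover_compact _ _ cS X setT B.
- exists [set y : full_shift G A |
    forall g, g \in ((DV x).1 : seq G) -> y g = set_val x g] => //.
  exact: ptws_open_agree.
- by exists x.
have [D DP] : exists D : {fset G}, forall x, x \in K -> ((DV x).1 `<=` D)%fset.
  exists (\bigcup_(x <- K) (DV x).1)%fset => x xK.
  exact: bigfcup_sup.
exists D => x; have [z zK zx] := KT x I.
have [UV VP] := DVP z; exists (DV z).2 => // y yx; apply: VP => g gz.
by rewrite yx ?zx// (fsubsetP (DP z zK)).
Qed.

Hypothesis Ffolner : is_folner R F.
Hypothesis Fcard : forall k, exists n, forall m, (n <= m)%N -> (k <= #|` F m|)%N.

Lemma weight_small (s e : R) m : 0 < s -> 0 < e ->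
  exists2 n, (m <= n)%N & forall j, (n <= j)%N -> weight s j <= e.
Proof.
(* Since [expR x >= x], the bound [#|F j| >= (s * e)^-1] gives [expR (s * #|F j|) >= e^-1]. *)
move=> s0 e0; have [n nP] := Fcard (Num.bound (s * e)^-1).
exists (maxn m n); first exact: leq_maxl.
move=> j; rewrite geq_max => /andP[_ /nP nj].
have kse : (s * e)^-1 <= #|` F j|%:R.
  apply: le_trans (ltW (archi_boundP _)) _; last by rewrite ler_nat.
  by rewrite invr_ge0 mulr_ge0// ltW.
rewrite /weight mulNr expRN -[e]invrK lef_pV2 ?posrE ?expR_gt0 ?invr_gt0//.
apply: le_trans (_ : s * #|` F j|%:R <= _).
  by move: kse; rewrite invfM mulrC ler_pdivrMr// mulrC.
by apply: le_trans (expR_ge1Dx _); rewrite lerDr.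
Qed.

(** A cheap cover by cylinders over the sets [F j] is cut further by the patterns on
    [boundary D (F j)]. Each piece lies in the set of one word of [U], and the Folner condition
    keeps the number of pieces subexponential. *)
Lemma bowen_M_high (Z : set X) (U : set (set X)) (h s B : R) :
  finite_open_cover U -> h < s ->
  (forall N, content code (weight h) N Z <= B%:E)%E ->
  bowen_M act F Z U s = 0%E.
Proof.
move=> cU hs ZB; apply: bowen_M_eq0 => N e e0.
(* One half of the gap pays for the number of pieces, the other yields the small factor
   [weight eps n]. *)
pose eps := (s - h) / 2.
have eps0 : 0 < eps by rewrite divr_gt0// subr_gt0.
have [D DU] := cover_window cU.
have /choice[V VP] : forall x : X, exists V, U V /\
    forall y : X, (forall g, g \in D -> set_val y g = set_val x g) -> V y.
  by move=> x; have [V ? ?] := DU x; exists V.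
pose a : R := #|A|%:R.
have a0 : 0 <= a by [].
(* From [#|A| <= expR a], the number of boundary patterns is at most the exponential of [a] times
   the boundary size. *)
have [J JP] := @folner_boundary R G F Ffolner D (eps / (a + 1))
  (divr_gt0 eps0 (ltr_wpDl a0 ltr01)).
have countP j : (J <= j)%N ->
    (#|A| ^ #|` boundary D (F j)|)%N%:R <= expR (eps * #|` F j|%:R).
  move=> /JP bj; rewrite natrX.
  apply: (@le_trans _ _ (expR a ^+ #|` boundary D (F j)|)).
    apply: lerXn2r; rewrite ?nnegrE ?expR_ge0//.
    by apply: le_trans (expR_ge1Dx _); rewrite lerDr.
  rewrite -expRM_natl ler_expR mulrC.
  apply: (le_trans (ler_wpM2l a0 bj)); rewrite mulrA ler_wpM2r//.
  rewrite mulrCA; apply: ler_piMr; first exact: ltW.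
  by rewrite ler_pdivrMr ?ltr_wpDl// mul1r lerDl.
have B0 : 0 <= B.
  by rewrite -lee_fin; apply: le_trans (ZB 0%N); apply: content_ge0; exact: weight_ge0.
have e'0 : 0 < e / (B + 1) by rewrite divr_gt0// ltr_wpDl.
have [n + wn] := weight_small (maxn N J) eps0 e'0.
rewrite geq_max => /andP[Nn Jn]; exists n => //.
have [|L [Ln ZL] cL] := @content_lt _ _ _ code (weight h) n Z (B + 1)%:E.
  by apply: le_lt_trans (ZB n) _; rewrite lte_fin ltrDl.
have /choice[P PP] : forall j, exists P : {fset {fmap G -> A}},
    (forall x : full_shift G A, pattern (boundary D (F j)) x \in P) /\
    (#|` P| <= #|A| ^ #|` boundary D (F j)|)%N.
  by move=> j; exact: pattern_fset.
pose T := {fmap G -> A}.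
pose K := [set k : (nat * T) * T | exists x : X, cyl code k.1 x /\
  pattern (boundary D (F k.1.1)) (set_val x) = k.2].
pose LP := L `*`` (fun q => [set` P q.1]).
have /choice[v vP] : forall k : (nat * T) * T, exists v : {fmap G -> set X},
    K k -> words U (F k.1.1) v /\
    forall y, cyl code k.1 y ->
      pattern (boundary D (F k.1.1)) (set_val y) = k.2 -> word_set act v y.
  move=> [[j t] p]; have [[x /= [xt xp]]|nK] := pselect (K (j, t, p)); last first.
    by exists [fmap]%fmap.
  (* [V (act g x)] contains all points agreeing with [act g x] on [D]. A point of the piece does so
     after acting by [g]: inside [F j] by the node, outside by the boundary pattern. *)
  exists [fmap g : F j => V (act (val g) x)] => _; split.
    by split => //= g; rewrite ffunE; exact: (VP _).1.
  move=> y yt yp g _ /=; rewrite ffunE; apply: (VP _).2 => d dD.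
  rewrite !set_val_act.
  have [dgF|dgF] := boolP ((d * val g)%g \in F j).
    have : code j y = code j x by rewrite [LHS]yt [RHS]xt.
    by move=> /patternP; exact.
  have : pattern (boundary D (F j)) (set_val y) =
         pattern (boundary D (F j)) (set_val x) by rewrite yp xp.
  move=> /patternP; apply; rewrite /boundary inE dgF /=.
  by apply/imfset2P; exists d => //; exists (val g) => //; exact: valP.
apply: (@le_trans _ _ (bowen_sum s (v @` (LP `&` K)))).
  apply: ereal_inf_lbound; exists (v @` (LP `&` K)) => //; split.
    move=> _ [k [[Lk _] /vP[kU _]] <-].
    by exists k.1.1 => //; exact: (Ln _ Lk).1.
  move=> x /ZL[q Lq qx].
  have Kqx : K (q, pattern (boundary D (F q.1)) (set_val x)) by exists x.
  exists (v (q, pattern (boundary D (F q.1)) (set_val x))).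
    by exists (q, pattern (boundary D (F q.1)) (set_val x)) => //; split => //;
      split => //; exact: (PP _).1.
  by apply: (vP _ Kqx).2.
apply: (@le_trans _ _ (\esum_(k in LP `&` K) (weight s k.1.1)%:E)).
  apply: (le_trans (@esum_image_le R _ _ v (LP `&` K)
    (fun u => (expR (- s * #|` domf u|%:R))%:E) _)).
    by move=> k _; rewrite lee_fin expR_ge0.
  apply: le_esum => k [_ Kk]; have [[vF _] _] := vP _ Kk.
  by rewrite vF.
apply: (@le_trans _ _ (\esum_(k in LP) (weight s k.1.1)%:E)).
  by apply: esum_le_subset => [k []//|k _]; rewrite lee_fin weight_ge0.
rewrite -(@esum_esum _ _ _ L (fun q => [set` P q.1])
  (fun q _ => (weight s q.1)%:E)); last first.
  by move=> *; rewrite lee_fin weight_ge0.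
apply: (@le_trans _ _ (\esum_(q in L) ((weight eps n)%:E * (weight h q.1)%:E)%E)).
  apply: le_esum => q Lq.
  rewrite esum_fset//=; last by move=> *; rewrite lee_fin weight_ge0.
  rewrite -fsbig_seq//= sumEFin big_const_seq count_predT iter_addr_0.
  rewrite -EFinM lee_fin -[leLHS]mulr_natl.
  have qn : (n <= q.1)%N := (Ln _ Lq).1.
  have card_le : #|` P q.1|%:R <= expR (eps * #|` F q.1|%:R).
    apply: le_trans (countP _ (leq_trans Jn qn)).
    by rewrite ler_nat (PP _).2.
  apply: le_trans (ler_wpM2r (weight_ge0 _ _) card_le) _.
  have -> : expR (eps * #|` F q.1|%:R) * weight s q.1 =
      weight eps q.1 * weight h q.1.
    by rewrite /weight -!expRD; congr expR; rewrite /eps; lra.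
  rewrite ler_wpM2r ?weight_ge0// /weight ler_expR.
  rewrite !mulNr lerN2 ler_pM2l// ler_nat.
  apply: fsubset_leq_card; move: qn => /subnK <-.
  elim: (q.1 - n)%N => //= i IHi; exact: fsubset_trans IHi (Fmono _).
apply: le_trans (esum_mull_le _ _ _) _.
- by rewrite lee_fin weight_ge0.
- by move=> q; rewrite lee_fin weight_ge0.
have wnn : weight eps n <= e / (B + 1) by exact: wn.
apply: (@le_trans _ _ ((e / (B + 1))%:E * (B + 1)%:E)%E); last first.
  by rewrite -EFinM lee_fin divfK// gt_eqF// ltr_wpDl.
apply: lee_pmul; rewrite ?lee_fin ?weight_ge0//; last exact: ltW.
by apply: esum_ge0 => q _; rewrite lee_fin weight_ge0.
Qed.

Lemma bowen_entropy_le (Z : set X) (h B : R) : 0 <= h ->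
  (forall N, content code (weight h) N Z <= B%:E)%E ->
  (bowen_entropy R act F Z <= h%:E)%E.
Proof.
move=> h0 ZB; apply: ge_ereal_sup => _ [U cU <-].
apply/lee_addgt0Pr => e e0; apply: ereal_inf_lbound.
exists (h + e) => //; split; first by rewrite addr_ge0// ltW.
by apply: (bowen_M_high cU _ ZB); rewrite ltrDl.
Qed.

(** * Subsets of prescribed entropy *)

Lemma net_compact_box (f : {ptws nat -> nat} -> X) (b : nat -> nat) :
  continuous f ->
  net_compact code (f @` [set s : {ptws nat -> nat} | forall i, (s i <= b i)%N]).
Proof.
move=> cf L fL.
have cC : compact (f @` [set s : {ptws nat -> nat} | forall i, (s i <= b i)%N]).
  apply: continuous_compact; last exact: compact_box.
  exact: continuous_subspaceT.
have [|D DL CD] := compact_cover_compact cC _ fL.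
  by move=> q _; exact: open_cyl.
by exists D => // q /DL/set_mem.
Qed.

Lemma lowerable (K : set X) (r : R) : souslin K -> 0 < r ->
  (r%:E < bowen_entropy R act F K)%E ->
  exists2 E, E `<=` K & bowen_entropy R act F E = r%:E.
Proof.
move=> sK r0 rK.
have r_small e m : 0 < e -> exists2 n, (m <= n)%N & weight r n <= e.
  by move=> e0; have [n mn /(_ n (leqnn n))] := weight_small m r0 e0; exists n.
(* If all contents vanished, [bowen_entropy_le] with bound 0 would give entropy at most [r]. *)
have [N NK] : exists N, (0 < content code (weight r) N K)%E.
  apply: contrapT => /forallNP K0; move: rK; rewrite ltNge => /negP; apply.
  apply: (@bowen_entropy_le _ _ 0); first exact: ltW.
  by move=> N; rewrite leNgt; apply/negP/K0.
have [K0|[f cf fK]] := sK.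
  by move: NK; rewrite K0 content0 ?ltxx//; exact: weight_ge0.
have [d d0 dK] : exists2 d : R, 0 < d & (d%:E < content code (weight r) N (range f))%E.
  have := NK; rewrite -fK.
  rewrite -[content _ _ _ _]fineK; last first.
    by apply: content_fin_num; [exact: code_finite|exact: weight_ge0].
  rewrite lte_fin => c0; exists (fine (content code (weight r) N (range f)) / 2).
    by rewrite divr_gt0.
  by rewrite lte_fin ltr_pdivrMr// ltr_pMr// ltr1n.
have [b bd] := content_baire code_refine code_finite (weight_ge0 r) dK.
pose C := f @` [set s | forall i, (s i <= b i)%N].
(* The preimage of a cylinder cover of [C] is open, so by [open_box] it contains a box with only [k]
   bounded coordinates, whose image has content above [d]. *)
have dC : (d%:E <= content code (weight r) N C)%E.
  apply: le_content => L [LN CL].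
  have oL : open (f @^-1` cylU code L).
    apply: open_comp; first by move=> s _; exact: cf.
    by apply: bigcup_open => q _; exact: open_cyl.
  have [s sb|k kL] := open_box oL (b := b); first by apply: CL; exists s.
  apply: le_trans (ltW (bd k)) _; apply: content_le; split => //.
  by move=> _ [s sk <-]; exact: kL.
have [E EC [CE Efin]] := subset_finite_content code_refine code_finite
  (weight_ge0 r) N r_small (net_compact_box cf : net_compact code C).
exists E; first by move=> x /EC [s _ <-]; rewrite -fK; exists s.
apply/eqP; rewrite eq_le; apply/andP; split.
  have EB k : (content code (weight r) k E <=
      (fine (content code (weight r) N E))%:E)%E.
    rewrite fineK//; apply: content_fin_num; [exact: code_finite|exact: weight_ge0].
  by apply: bowen_entropy_le EB; exact: ltW.
apply: (@bowen_entropy_ge _ N); apply: lt_le_trans CE.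
by apply: lt_le_trans dC; rewrite lte_fin.
Qed.

Lemma bowen_entropy_set0 : bowen_entropy R act F set0 = 0%E.
Proof.
apply/eqP; rewrite eq_le; apply/andP; split.
  apply: (@bowen_entropy_le _ 0 0) => // N.
  by rewrite content0//; exact: weight_ge0.
apply: (@le_trans _ _ (bowen_entropy_cover R act F set0 coord_cover)).
  by apply: le_ereal_inf_tmp => _ [s [s0 _] <-]; rewrite lee_fin.
by apply: ereal_sup_ubound; exists coord_cover => //; exact: coord_coverP.
Qed.

End subshift_entropy.

Theorem theorem4p7 (R : realType) (G : groupType)
    (Gcountable : countable [set: G]) (Ginfinite : infinite_set [set: G])
    (Gamenable : amenable R G)
    (F : nat -> {fset G}) (Ffolner : is_folner R F)
    (F1 : (1%g : G) \in F 0%N) (Fmono : forall n, (F n `<=` F n.+1)%fset)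
    (A : finType) (A2 : (2 <= #|A|)%N) (S : subshift G A) :
  D_hereditarily_lowerable R (@subshift_act G A S) F.
Proof.
move=> K _ sK h h0 hK.
have Fcard := folner_card_unbounded Ffolner Ginfinite F1 Fmono.
(* At the top value, possibly infinite, [K] itself serves; any smaller [h] is real, and the empty
   set serves for 0. *)
have [hK'|hK'] := eqVneq h (bowen_entropy R (@subshift_act G A S) F K).
  by exists K.
have {hK hK'} ltK : (h < bowen_entropy R (@subshift_act G A S) F K)%E.
  by rewrite lt_neqAle hK'.
case: h h0 ltK => [r|_|//]; last by rewrite ltNge leey.
rewrite lee_fin le_eqVlt => /orP[/eqP <- _|r0 rK].
  exists set0 => //; exact: (bowen_entropy_set0 _ Fmono Ffolner Fcard).
exact: (lowerable Fmono Ffolner Fcard).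
Qed.
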